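(* Let $q$ be a power of an odd prime $p$ and let $n=2^{e_0}p_1^{e_1}\cdots p_s^{e_s}$, where $p_1,\dots,p_s$ are distinct odd primes different from $p$ and $e_0,e_1,\dots,e_s$ are positive integers; let $n'=p_1^{e_1}\cdots p_s^{e_s}$ and let $\eta=(\eta_1,\dots,\eta_s)$ be a primitive root system modulo $n'$. For $x=(x_1,\dots,x_s)$ write $\eta^x=\eta_1^{x_1}\cdots\eta_s^{x_s}$. If $q^{\mathrm{ord}_{n'}(q)}\equiv1\pmod4$, then the irreducible factorization of $\Phi_n(X)$ over $\mathbb{F}_q$ is given by $$\Phi_n(X)=\prod_{x\in\Sigma^{\ast}(n';q)}\prod_{t\in\{0,1\}^{s_{0,0}^+}}\left(\sum_{i=0}^{\omega_0}(-1)^{\omega_0-i}\Big(\sum_{\substack{U\subseteq\{0,\dots,\omega_0-1\}\\|U|=\omega_0-i}}\prod_{u\in U}\zeta_{r(x)_t^+}^{\widetilde{\mu}(x)_t^+q^u}\Big)X^{h(x)_t^+\cdot i}\right),$$ where $\widetilde{\mu}(x)_t^+=\eta^x+p_1^{e_1}\cdots p_s^{e_s}\cdot(U_0(\eta^x)+\sum_{j=1}^{s_{0,0}^+}t_j2^j)$, $r(x)_t^+=2^{\min\{e_0,v_2(q^{\mathrm{ord}_{n'}(q)}-1)\}}p_1^{e_1-M_1}\cdots p_s^{e_s-M_s}$, and $h(x)_t^+=2^{\max\{e_0-v_2(q^{\mathrm{ord}_{n'}(q)}-1),0\}}p_1^{M_1}\cdots p_s^{M_s}$. If $q^{\mathrm{ord}_{n'}(q)}\equiv3\pmod4$,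 then the irreducible factorization of $\Phi_n(X)$ over $\mathbb{F}_q$ is given by $$\Phi_n(X)=\prod_{x\in\Sigma^{\ast}(n';q)}\prod_{t\in\{0,1\}^{s_{0,0}^-}}\left(\sum_{i=0}^{\omega_0'}(-1)^{\omega_0'-i}\Big(\sum_{\substack{U\subseteq\{0,\dots,\omega_0'-1\}\\|U|=\omega_0'-i}}\prod_{u\in U}\zeta_{r(x)_t^-}^{\widetilde{\mu}(x)_t^-q^u}\Big)X^{h(x)_t^-\cdot i}\right),$$ where $\omega_0'=\omega_0$ if $e_0\le2$ and $\omega_0'=2\omega_0$ if $e_0\ge3$, $\widetilde{\mu}(x)_t^-=\eta^x+p_1^{e_1}\cdots p_s^{e_s}\cdot(U_0(\eta^x)+\sum_{j=1}^{s_{0,0}^-}t_j2^{j+1})$, $$r(x)_t^-=\begin{cases}2p_1^{e_1-M_1}\cdots p_s^{e_s-M_s},&e_0=1\text{ or }2;\\2^{\min\{e_0,v_2(q^{\mathrm{ord}_{n'}(q)}+1)+1\}}p_1^{e_1-M_1}\cdots p_s^{e_s-M_s},&e_0\ge3,\end{cases}$$ $$h(x)_t^-=\begin{cases}p_1^{M_1}\cdots p_s^{M_s},&e_0=1;\\2p_1^{M_1}\cdots p_s^{M_s},&e_0=2;\\2^{\max\{e_0-v_2(q^{\mathrm{ord}_{n'}(q)}+1)-1,0\}}p_1^{M_1}\cdots p_s^{M_s},&e_0\ge3.\end{cases}$$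
   Context: A compatible family $\{\zeta_N:\gcd(N,q)=1\}$ is fixed, where $\zeta_N$ is a primitive $N$-th root of unity in an algebraic closure of $\mathbb{F}_q$ and $\zeta_N^{N/M}=\zeta_M$ whenever $M\mid N$. $\Phi_n(X)=\prod_{0\le i<n,\ \gcd(i,n)=1}(X-\zeta_n^i)$. ''Irreducible factorization'' means each factor lies in $\mathbb{F}_q[X]$ and is irreducible over $\mathbb{F}_q$. $v_\ell$ is the $\ell$-adic valuation; $\mathrm{ord}_N(q)$ is the multiplicative order. An $s$-tuple $\eta=(\eta_1,\dots,\eta_s)$ of integers is a primitive root system modulo $n'=p_1^{e_1}\cdots p_s^{e_s}$ if for every $i$: $\eta_i$ is a primitive root modulo $p_i^{d}$ for all $d\ge1$, and $\eta_i\equiv1\pmod{p_j^{e_j}}$ for every $j\ne i$. Put $f_{i,0}=\mathrm{ord}_{p_i^{e_i}}(q)$, $g_{i,0}=\phi(p_i^{e_i})/f_{i,0}$. $\Sigma^{\ast}(n';q)$ is the set of $s$-tuples of integers $x=(x_1,\dots,x_s)$ with $0\le x_i\le g_{i,0}\gcd(\mathrm{lcm}(f_{1,0},\dots,f_{i-1,0}),f_{i,0})-1$ for all $i$ (for $i=1$ the gcd is understood to be $1$). $\omega_0=\mathrm{lcm}(\mathrm{ord}_{p_1}(q),\dots,\mathrm{ord}_{p_s}(q))$ and $M_i=\max\{e_i-v_{p_i}(q^{\omega_0}-1),0\}$. $s_{0,0}^+=\min\{e_0-1,\,v_2(q^{\mathrm{ord}_{n'}(q)}-1)-1\}$ and $s_{0,0}^-=\min\{e_0-2,\,v_2(q^{\mathrm{ord}_{n'}(q)}+1)-1\}$.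 When $s_{0,0}^{\pm}\le0$, $\{0,1\}^{s_{0,0}^\pm}$ is the one-element set $\{0\}$ and the sums over $j$ are empty; otherwise $t=(t_1,\dots,t_{s_{0,0}^\pm})$. For an integer $\gamma$, $U_0(\gamma)=1-\phi_{n',0}(\gamma)$, where $\phi_{n',0}(\gamma)\in\{0,1\}$ is the unique element with $2\mid\gamma+n'\phi_{n',0}(\gamma)$ (so $U_0(\gamma)=1$ if $\gamma$ is even and $U_0(\gamma)=0$ if $\gamma$ is odd). *)

(* Defs.v *)
From HB Require Import structures.
From mathcomp Require Import all_boot all_order all_algebra.
From mathcomp Require Import cyclic cyclotomic zify.

Set Implicit Arguments.
Unset Strict Implicit.
Unset Printing Implicit Defensive.

Import Order.TTheory GRing.Theory Num.Theory.

Local Open Scope ring_scope.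

Lemma mulord_exists (N : nat) (a : int) :
  exists k, (0 < k)%N && (coprimez a N ==> (a ^+ k == 1 %[mod N])%Z).
Proof.
have sqE : a ^+ 2 = (`|a| ^ 2)%N%:Z.
  by rewrite -mulnn PoszM abszE -expr2 -normrX ger0_norm ?sqr_ge0.
exists (2 * (totient N).-1.+1)%N; rewrite muln_gt0 /=.
apply/implyP => coaN; rewrite exprM sqE.
have {}coaN : coprime (`|a| ^ 2) N by rewrite coprimeXl.
have [N0|N_gt0] := posnP N.
  by move: coaN; rewrite N0 /coprime gcdn0 => /eqP ->; rewrite expr1n.
rewrite prednK ?totient_gt0 //.
have -> : (`|a| ^ 2)%N%:Z ^+ totient N = ((`|a| ^ 2) ^ totient N)%N%:Z.
  by rewrite -[in LHS]natz -natrX natz.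
by rewrite !modz_nat Euler_exp_totient.
Qed.

(* The order of a modulo N: the least k > 0 with a ^ k = 1 mod N when a and N
   are coprime, and the conventional value 1 otherwise. *)
Definition mulord (N : nat) (a : int) : nat := ex_minn (mulord_exists N a).

Lemma mulordP (N : nat) (a : int) : coprimez a N ->
  [/\ (0 < mulord N a)%N, (a ^+ mulord N a = 1 %[mod N])%Z
    & forall k : nat, (0 < k)%N -> (a ^+ k = 1 %[mod N])%Z ->
        (mulord N a <= k)%N].
Proof.
move=> coaN; rewrite /mulord; case: ex_minnP => m; rewrite coaN /=.
by case/andP=> m_gt0 /eqP ma mmin; split=> // k k0 ka; apply: mmin; rewrite k0 ka /=.
Qed.

Definition primitive_root_mod (N : nat) (a : int) : bool :=
  coprimez a N && (mulord N a == totient N).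

Definition primitive_root_system (s : nat) (p e : 'I_s -> nat)
    (eta : 'I_s -> int) : Prop :=
  forall i : 'I_s,
    (forall d : nat, (0 < d)%N -> primitive_root_mod (p i ^ d) (eta i)) /\
    (forall j : 'I_s, j != i -> (eta i = 1 %[mod (p j ^ e j)%N])%Z).

Definition is_algebraic_closure (F : fieldType) (L : closedFieldType)
    (iota : {rmorphism F -> L}) : Prop :=
  forall z : L, algebraicOver iota z.

Definition compatible_roots (q : nat) (L : fieldType) (zeta : nat -> L) : Prop :=
  (forall N : nat, coprime N q -> N.-primitive_root (zeta N)) /\
  (forall N M : nat, coprime N q -> (M %| N)%N ->
     zeta N ^+ (N %/ M) = zeta M).

Definition irreducible_over (F : fieldType) (L : fieldType)
    (iota : {rmorphism F -> L}) (P : {poly L}) : Prop :=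
  exists2 g : {poly F}, P = map_poly iota g & irreducible_poly g.

Definition odd_part (s : nat) (p e : 'I_s -> nat) : nat :=
  (\prod_(i < s) p i ^ e i)%N.

Definition f0 (s : nat) (p e : 'I_s -> nat) (q : nat) (i : 'I_s) : nat :=
  mulord (p i ^ e i) q.

Definition g0 (s : nat) (p e : 'I_s -> nat) (q : nat) (i : 'I_s) : nat :=
  (totient (p i ^ e i) %/ f0 p e q i)%N.

(* For the first index the lcm is empty, hence equal to 1, and so is the gcd. *)
Definition Sigma_bound (s : nat) (p e : 'I_s -> nat) (q : nat) (i : 'I_s) : nat :=
  (g0 p e q i
   * gcdn (\big[lcmn/1]_(j < s | j < i) f0 p e q j) (f0 p e q i))%N.

Notation Sigma_star p e q :=
  {dffun forall i, 'I_(Sigma_bound p e q i)}.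

Definition eta_pow (s : nat) (p e : 'I_s -> nat) (q : nat) (eta : 'I_s -> int)
    (x : Sigma_star p e q) : int :=
  \prod_(i < s) eta i ^+ x i.

Definition omega0 (s : nat) (p : 'I_s -> nat) (q : nat) : nat :=
  \big[lcmn/1%N]_(i < s) mulord (p i) q.

(* Natural number subtraction is truncated: this is max(e i - v, 0). *)
Definition Mexp (s : nat) (p e : 'I_s -> nat) (q : nat) (i : 'I_s) : nat :=
  (e i - logn (p i) (q ^ omega0 p q - 1))%N.

Definition r_odd (s : nat) (p e : 'I_s -> nat) (q : nat) : nat :=
  (\prod_(i < s) p i ^ (e i - Mexp p e q i))%N.

Definition h_odd (s : nat) (p e : 'I_s -> nat) (q : nat) : nat :=
  (\prod_(i < s) p i ^ Mexp p e q i)%N.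

Definition phi0 (n' : nat) (gamma : int) : 'I_2 :=
  odflt ord0 [pick f : 'I_2 | (2 %| gamma + n'%:Z * (f : nat)%:Z)%Z].

Definition U0 (n' : nat) (gamma : int) : int := 1 - (phi0 n' gamma : nat)%:Z.

Lemma phi0_unique (n' : nat) (gamma : int) (f : 'I_2) : odd n' ->
  (2 %| gamma + n'%:Z * (f : nat)%:Z)%Z = (f == phi0 n' gamma).
Proof.
move=> on.
have key (k : 'I_2) : (2 %| gamma + n'%:Z * (k : nat)%:Z)%Z = (odd `|gamma|%N == odd k).
  rewrite dvdzE /= dvdn2.
  have oddD (a b : int) : odd `|(a + b)%R|%N = odd `|a|%N (+) odd `|b|%N.
    case: a b => [a|a] [b|b]; rewrite -?NegzE //=; lia.
  by rewrite oddD abszM oddM on /=; case: (odd _); case: (odd _).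
rewrite /phi0; case: pickP => [g /= | /(_ (inord (odd `|gamma|%N)))].
  rewrite !key => /eqP->; case: f g => [[|[|f]] ?] [[|[|g]] ?] //.
by rewrite /= key inordK ?oddb ?eqxx //; case: (odd _).
Qed.

(* In the next six definitions Q stands for q ^ ord_{n'}(q).  Truncated
   subtraction replaces a negative s_{0,0} by 0, which gives the same one-element
   index set {0,1}^0 and the same empty sums. *)
Definition s_plus (e0 Q : nat) : nat := minn (e0 - 1) (logn 2 (Q - 1) - 1).

Definition s_minus (e0 Q : nat) : nat := minn (e0 - 2) (logn 2 (Q + 1) - 1).

Definition r_plus (s : nat) (p e : 'I_s -> nat) (q e0 Q : nat) : nat :=
  (2 ^ minn e0 (logn 2 (Q - 1)) * r_odd p e q)%N.

Definition h_plus (s : nat) (p e : 'I_s -> nat) (q e0 Q : nat) : nat :=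
  (2 ^ (e0 - logn 2 (Q - 1)) * h_odd p e q)%N.

Definition r_minus (s : nat) (p e : 'I_s -> nat) (q e0 Q : nat) : nat :=
  ((if e0 <= 2 then 2 else 2 ^ minn e0 (logn 2 (Q + 1) + 1)) * r_odd p e q)%N.

Definition h_minus (s : nat) (p e : 'I_s -> nat) (q e0 Q : nat) : nat :=
  ((if e0 == 1 then 1 else if e0 == 2 then 2
    else 2 ^ (e0 - (logn 2 (Q + 1) + 1))) * h_odd p e q)%N.

(* The sums run over j = 1, ..., m; the index of t is shifted by one. *)
Definition mu_plus (n' : nat) (gamma : int) (m : nat)
    (t : {ffun 'I_m -> 'I_2}) : int :=
  gamma + n'%:Z * (U0 n' gamma + (\sum_(j < m) t j * 2 ^ j.+1)%N%:Z).

Definition mu_minus (n' : nat) (gamma : int) (m : nat)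
    (t : {ffun 'I_m -> 'I_2}) : int :=
  gamma + n'%:Z * (U0 n' gamma + (\sum_(j < m) t j * 2 ^ j.+2)%N%:Z).

Definition omega0' (s : nat) (p : 'I_s -> nat) (q e0 : nat) : nat :=
  if (e0 <= 2)%N then omega0 p q else (2 * omega0 p q)%N.

Definition explicit_factor (L : fieldType) (zeta : nat -> L)
    (q w r h : nat) (mu : int) : {poly L} :=
  \sum_(i < w.+1)
    ((-1) ^+ (w - i)
      * \sum_(U : {set 'I_w} | #|U| == (w - i)%N)
          \prod_(u in U) zeta r ^ (mu * (q ^ u)%N%:Z)) *: 'X^(h * i).

(* Main.v *)
Require Import Defs.
From mathcomp Require Import all_boot all_order all_algebra.
From mathcomp Require Import finfield cyclic cyclotomic zify ring.

Import GRing.Theory Num.Theory.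

Local Open Scope ring_scope.

(* By Vieta, [explicit_factor zeta q w r h mu] is the product over [u < w] of
   [X^h - zeta_r^(mu q^u)].  When [r] divides [q^w - 1] and [n = r h] has
   [ord_n(q) = h w], its roots are exactly the [h w] conjugates of [zeta_n^mu]
   under [x |-> x^q], which makes it the minimal polynomial of [zeta_n^mu].
   Lifting the exponent at each prime gives [ord_n(q) = h w] for the stated
   [r], [w], [h].  The exponents [mu] represent distinct cosets of [<q>] in the
   units modulo [n]: [eta^x] is recovered modulo [n'], and then the binary digits
   [t] modulo the power of [2] that divides [q^j - 1] whenever [q^j = 1 mod n'].
   Since the degrees add up to [phi(n)], these are all the roots of [Phi_n]. *)

(** * Lifting the exponent and finite products *)

Section NatArithmetic.
Local Open Scope nat_scope.

Lemma logn_eq1 (p m : nat) : prime p -> m = p %[mod p ^ 2] -> logn p m = 1.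
Proof.
move=> p_pr mp; have p_gt0 := prime_gt0 p_pr; have p_gt1 := prime_gt1 p_pr.
have m_gt0 : 0 < m.
  rewrite lt0n; apply/eqP => m0; move: mp.
  by rewrite m0 mod0n modn_small ?ltn_Pmull //; lia.
apply/eqP; rewrite eqn_leq -[_ <= 1]negbK -ltnNge -!pfactor_dvdn // expn1.
rewrite [p ^ 2 %| m]/dvdn mp modn_small ?(ltn_Pmull p_gt1) // -lt0n p_gt0 /=.
by rewrite /dvdn -(@modn_dvdm (p ^ 2) m p) ?mp ?modn_dvdm ?modnn // dvdn_mulr.
Qed.

Lemma expnS_mod_sqr (b i : nat) : b.+1 ^ i = 1 + i * b %[mod b ^ 2].
Proof.
elim: i => [|i IH]; first by rewrite mul0n.
rewrite expnS -modnMmr IH modnMmr.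
by rewrite (_ : b.+1 * (1 + i * b) = i * b ^ 2 + (1 + i.+1 * b)) ?modnMDl //; ring.
Qed.

(** Modulo [b ^ 2] the sum is [p + 'C(p, 2) * b]. For odd [p] both ['C(p, 2)] and [b] contain a
    factor [p]; for [p = 2] the sum is [2 + b], hence the condition modulo 4. *)
Lemma geometric_sum_mod (p b : nat) : prime p -> p %| b -> (p == 2 -> 4 %| b) ->
  \sum_(i < p) b.+1 ^ i = p %[mod p ^ 2].
Proof.
move=> p_pr pb b4; have [p2|p_neq2] := eqVneq p 2.
  move: b4; rewrite p2 eqxx => /(_ isT) /dvdnP[c ->].
  rewrite !big_ord_recl big_ord0 /= /bump /= expn1 expn0.
  by rewrite (_ : 1 + ((c * 4).+1 + 0) = c * 2 ^ 2 + 2) ?modnMDl //; lia.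
have p2b2 : p ^ 2 %| b ^ 2 by rewrite dvdn_exp2r.
rewrite -modn_summ (eq_bigr (fun i : 'I_p => (1 + i * b) %% p ^ 2)); last first.
  by move=> i _; rewrite -(modn_dvdm _ p2b2) expnS_mod_sqr modn_dvdm.
rewrite modn_summ big_split /= sum_nat_const card_ord muln1 -big_distrl /=.
rewrite -(big_mkord xpredT id) bin2_sum -modnDmr.
have /eqP-> : 'C(p, 2) * b == 0 %[mod p ^ 2]; last by rewrite mod0n addn0.
rewrite mod0n -/(dvdn _ _) expnS expn1 dvdn_mul // prime_dvd_bin //=.
by rewrite ltn_neqAle eq_sym p_neq2 prime_gt1.
Qed.

Lemma sum_expnS_mod (p b m : nat) : p %| b ->
  \sum_(i < m) b.+1 ^ i = m %[mod p].
Proof.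
move=> pb; rewrite -modn_summ (eq_bigr (fun=> 1 %% p)).
  by rewrite modn_summ sum_nat_const card_ord muln1.
move=> i _; rewrite -modnXm -addn1 -modnDml.
by move: pb; rewrite /dvdn => /eqP->; rewrite add0n modnXm exp1n.
Qed.

(** Lifting the exponent, by induction on [m]. If [p] does not divide [m], the cofactor of [a - 1]
    is [m] modulo [p], hence prime to [p]. Otherwise [a] is replaced by [a ^ p], which raises the
    valuation by exactly 1. *)
Lemma logn_expn_sub1 (p a m : nat) : prime p -> 1 < a -> p %| a - 1 ->
  (p == 2 -> 4 %| a - 1) -> 0 < m ->
  logn p (a ^ m - 1) = logn p (a - 1) + logn p m.
Proof.
move=> p_pr; elim/ltn_ind: m a => m IH a a_gt1 pa a4 m_gt0.
have a_def : a = (a - 1).+1 by lia.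
have lognP k : 0 < k -> logn p (a ^ k - 1) =
    logn p (a - 1) + logn p (\sum_(i < k) a ^ i).
  move=> k_gt0; rewrite subn1 predn_exp -subn1 lognM ?subn_gt0 //.
  by rewrite -(prednK k_gt0) big_ord_recl.
have [/dvdnP[m1 m_def]|pNm] := boolP (p %| m); last first.
  rewrite lognP // [RHS](_ : _ = logn p (a - 1) + 0).
    congr addn; apply/eqP; rewrite lognE p_pr.
    rewrite [p %| _]/dvdn a_def sum_expnS_mod // -/(dvdn p m) (negPf pNm).
    by rewrite andbF.
  by congr addn; rewrite lognE p_pr (negPf pNm) andbF.
have m1_gt0 : 0 < m1 by lia.
have p_gt1 := prime_gt1 p_pr; have p_gt0 := prime_gt0 p_pr.
have dva : a - 1 %| a ^ p - 1 by rewrite !subn1 predn_exp dvdn_mulr.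
rewrite m_def mulnC expnM IH //; first last.
- by move/a4 => a4'; apply: dvdn_trans dva.
- exact: dvdn_trans dva.
- by rewrite -(exp1n p) ltn_exp2r.
- by rewrite m_def ltn_Pmulr.
rewrite lognP // lognM // (pfactorK 1) // addnA; congr (_ + _ + _).
by apply: logn_eq1 => //; rewrite a_def geometric_sum_mod.
Qed.

Lemma dvdn_expn_sub1 (p a m e : nat) : prime p -> 1 < a -> p %| a - 1 ->
  (p == 2 -> 4 %| a - 1) -> 0 < m ->
  (p ^ e %| a ^ m - 1) = (p ^ (e - logn p (a - 1)) %| m).
Proof.
move=> p_pr a_gt1 pa a4 m_gt0.
have am_gt1 : 1 < a ^ m by rewrite -(exp1n m) ltn_exp2r.
by rewrite !pfactor_dvdn ?subn_gt0 // logn_expn_sub1 // leq_subLR.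
Qed.

Lemma prod_dvdn (I : finType) (f : I -> nat) (m : nat) :
  (forall i j, i != j -> coprime (f i) (f j)) ->
  (\prod_i f i %| m) = [forall i, f i %| m].
Proof.
move=> cof.
have cop (r : seq I) i : i \notin r -> coprime (f i) (\prod_(j <- r) f j).
  elim: r => [|j r IH]; first by rewrite big_nil coprimen1.
  by rewrite inE negb_or big_cons coprimeMr => /andP[/cof-> /IH].
have step (r : seq I) : uniq r ->
    (\prod_(i <- r) f i %| m) = all (fun i => f i %| m) r.
  elim: r => [|i r IH] /=; first by rewrite big_nil dvd1n.
  by case/andP=> ir ur; rewrite big_cons Gauss_dvd ?cop // IH.
rewrite step ?index_enum_uniq //; apply/allP/forallP => [H i|H i _] //.
exact: H (mem_index_enum i).
Qed.

(** Iterates lcm(a, b) gcd(a, b) = a b. The gcds are those of [Sigma_bound], so this is what gives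
    [Sigma_star] its size. *)
Lemma prod_lcm_gcd (s : nat) (f : 'I_s -> nat) :
  \prod_i f i =
  (\big[lcmn/1]_i f i * \prod_(i < s) gcdn (\big[lcmn/1]_(j < s | j < i) f j) (f i)).
Proof.
elim: s f => [|s IH] f; first by rewrite !big_ord0.
rewrite !big_ord_recr /= {}IH.
have eq_lcm (i : nat) : i <= s -> \big[lcmn/1]_(j < s.+1 | j < i) f j =
    \big[lcmn/1]_(j < s | j < i) f (widen_ord (leqnSn s) j).
  by move=> le_is; rewrite big_mkcond big_ord_recr /= ltnNge le_is lcmn1 -big_mkcond.
have -> : \prod_(i < s) gcdn (\big[lcmn/1]_(j < s.+1 | j < i) f j)
      (f (widen_ord (leqnSn s) i)) =
    \prod_(i < s) gcdn (\big[lcmn/1]_(j < s | j < i)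
      f (widen_ord (leqnSn s) j)) (f (widen_ord (leqnSn s) i)).
  by apply: eq_bigr => i _; rewrite eq_lcm // ltnW.
have -> : \big[lcmn/1]_(j < s.+1 | j < @ord_max s) f j =
    \big[lcmn/1]_(j < s) f (widen_ord (leqnSn s) j).
  by rewrite eq_lcm //; apply: eq_bigl => j; rewrite ltn_ord.
by rewrite [RHS]mulnCA muln_lcm_gcd [LHS]mulnAC mulnC.
Qed.

End NatArithmetic.

(** * Frobenius orbits of roots of unity *)

(** Expanding the product picks a set [U] of factors contributing [- c u], the others contributing
    [Y]; the sets are then grouped by the resulting power of [Y]. *)
Lemma prod_subC_Vieta (L : comNzRingType) (w : nat) (Y : {poly L}) (c : nat -> L) :
  \prod_(u < w) (Y - (c u)%:P) =
  \sum_(i < w.+1)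
    ((-1) ^+ (w - i)
      * \sum_(U : {set 'I_w} | #|U| == (w - i)%N) \prod_(u in U) c u) *: Y ^+ i.
Proof.
have termE (U : {set 'I_w}) :
    \prod_u (if u \in U then - (c u)%:P else Y) =
    ((-1) ^+ #|U| * \prod_(u in U) c u) *: Y ^+ (w - #|U|).
  rewrite (bigID (mem U)) /= (eq_bigr (fun u : 'I_w => - (c u)%:P)); last by move=> u ->.
  rewrite (eq_bigr (fun=> Y) (P := fun u : 'I_w => u \notin U)); last by move=> u /negPf->.
  rewrite prodrN -rmorph_prod /= prodr_const.
  have -> : #|[pred u | u \notin U]| = (w - #|U|)%N.
    have := cardC (mem U); rewrite card_ord => /(congr1 (subn^~ #|U|)) <-.
    by rewrite addKn; apply: eq_card.
  by rewrite -mul_polyC rmorphM rmorphXn rmorphN1.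
under eq_bigr do rewrite addrC.
rewrite bigA_distr /=.
rewrite (eq_bigr _ (fun U _ => termE U)).
have U_le (U : {set 'I_w}) : (#|U| <= w)%N by have := max_card (mem U); rewrite card_ord.
rewrite (partition_big (fun U : {set 'I_w} => inord (w - #|U|) : 'I_w.+1) xpredT) //=.
apply: eq_bigr => i _; rewrite mulr_sumr scaler_suml.
have i_le : (i <= w)%N by rewrite -ltnS.
have UE (U : {set 'I_w}) :
    (inord (w - #|U|) == i) = (#|U| == (w - i)%N).
  have := U_le U; rewrite -val_eqE /= inordK; last by rewrite ltnS leq_subr.
  by move: i_le; set a := #|U|; move: (nat_of_ord i) => b; lia.
apply: eq_big => U; first by rewrite UE.
by rewrite UE => /eqP->; rewrite subKn.
Qed.

Lemma prim_expz_eq1 (L : fieldType) (n : nat) (z : L) (m : int) :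
  n.-primitive_root z -> (z ^ m == 1) = (n %| m)%Z.
Proof.
move=> prim_z; case: m => m; first by rewrite -(prim_order_dvd prim_z) dvdzE.
by rewrite NegzE -exprnN invr_eq1 -(prim_order_dvd prim_z) dvdzE abszN.
Qed.

Lemma prim_expz_eq (L : fieldType) (n : nat) (z : L) (a b : int) :
  n.-primitive_root z -> (z ^ a == z ^ b) = (n %| a - b)%Z.
Proof.
move=> prim_z; rewrite -(prim_expz_eq1 _ _ _ _ prim_z).
have z_neq0 := prim_root_eq0 prim_z; have n_gt0 := prim_order_gt0 prim_z.
have {}z_neq0 : z != 0 by rewrite z_neq0 -lt0n.
have zb_neq0 : z ^ b != 0 by rewrite expfz_neq0.
by rewrite expfzDr // -invr_expz -[RHS](inj_eq (mulIf zb_neq0)) mulfVK ?mul1r.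
Qed.

(** Over [F] the polynomial X^q - X, with q = [#|F|], splits into the ['X - x%:P], so its roots in
    [L] are images of elements of [F]. *)
Lemma expf_card_in_image (F : finFieldType) (L : fieldType)
    (iota : {rmorphism F -> L}) (c : L) :
  c ^+ #|F| = c -> exists x, c = iota x.
Proof.
move=> cq; have /eqP : (map_poly iota ('X^#|F| - 'X)).[c] = 0.
  by rewrite rmorphB /= map_polyXn map_polyX !hornerE cq subrr.
rewrite finField_genPoly rmorph_prod horner_prod prodf_seq_eq0 => /hasP[x _].
by rewrite /= rmorphB /= map_polyX map_polyC !hornerE subr_eq0 => /eqP; exists x.
Qed.

Lemma Frobenius_power_rmorphism (p k : nat) (L : fieldType) :
  p \in [pchar L] -> exists f : {rmorphism L -> L}, forall x, f x = x ^+ (p ^ k).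
Proof.
move=> pL; elim: k => [|k [f fE]]; first by exists idfun => x; rewrite expr1.
by exists (pFrobenius_aut pL \o f) => x; rewrite /= fE expnSr exprM.
Qed.

Lemma cyclic_shift_prod (R : comNzRingType) (N : nat) (G : nat -> R) :
  G N = G 0%N -> \prod_(i < N) G i.+1 = \prod_(i < N) G i.
Proof.
by case: N => [|N] GN; rewrite ?big_ord0 // big_ord_recr big_ord_recl /= GN mulrC.
Qed.

(** Frobenius permutes the linear factors cyclically, so the coefficients are fixed and come from
    [F]. The roots of a nonconstant divisor over [F] are stable under Frobenius, so one root of the
    orbit brings all [N] of them and the divisor has full degree. *)
Lemma irreducible_Frobenius_orbit (F : finFieldType) (L : closedFieldType)
    (iota : {rmorphism F -> L}) (f : {rmorphism L -> L}) (y : L) (N : nat) :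
  (forall x, f x = x ^+ #|F|) -> (0 < N)%N ->
  y ^+ (#|F| ^ N) = y ->
  {in gtn N &, injective (fun i : nat => y ^+ (#|F| ^ i))} ->
  irreducible_over iota (\prod_(i < N) ('X - (y ^+ (#|F| ^ i))%:P)).
Proof.
set q := #|F| => fE N_gt0 yN y_inj; set P := \prod_(i < N) _.
have sizeP : size P = N.+1 by rewrite size_prod_XsubC /index_enum -enumT size_enum_ord.
have fP : map_poly f P = P.
  rewrite /P rmorph_prod /= -(cyclic_shift_prod _ _ (fun i => 'X - (y ^+ (q ^ i))%:P)).
    apply: eq_bigr => i _; rewrite rmorphB /= map_polyX map_polyC /= fE.
    by rewrite -exprM -expnSr.
  by rewrite yN expr1.
have Pcoef j : exists x, P`_j == iota x.
  have [|x ->] := expf_card_in_image _ _ iota P`_j; last by exists x.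
  by rewrite -fE -coef_map fP.
pose g := \poly_(j < N.+1) xchoose (Pcoef j).
have gP : P = map_poly iota g.
  apply/polyP => j; rewrite coef_map coef_poly; case: ltnP => jN.
    exact/eqP/(xchooseP (Pcoef j)).
  by rewrite nth_default ?sizeP //; apply/esym/rmorph0.
exists g => //; have sizeg : size g = N.+1 by rewrite -sizeP gP size_map_poly.
split=> [|d d_neq1 d_dvd]; first by rewrite sizeg.
have [|x x_root] := closed_rootP (map_poly iota d) _; first by rewrite size_map_poly.
have [i x_def] : exists i : nat, x = y ^+ (q ^ i).
  have : root P x by apply: root_dvdp x_root; rewrite gP dvdp_map.
  rewrite /root /P horner_prod prodf_seq_eq0 => /hasP[i _].
  by rewrite /= !hornerE subr_eq0 => /eqP->; exists i.
have q_root v : root (map_poly iota d) v -> root (map_poly iota d) (v ^+ q).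
  move=> v_root; have : root (map_poly f (map_poly iota d)) (f v) by rewrite rmorph_root.
  rewrite fE -map_poly_comp (eq_map_poly (_ : f \o iota =1 iota)) // => a /=.
  by rewrite fE -rmorphXn /= expf_card.
have orbit j : root (map_poly iota d) (y ^+ (q ^ (i + j))).
  elim: j => [|j IH]; first by rewrite addn0 -x_def.
  by rewrite addnS expnSr exprM q_root.
have period j m : y ^+ (q ^ (j + m * N)) = y ^+ (q ^ j).
  elim: m => [|m IH]; first by rewrite addn0.
  by rewrite mulSn addnCA expnD exprM yN.
(* So far the roots are known only from index [i] on; adding [i * N] to [j] moves past [i] without
   changing the root. *)
have {}orbit j : root (map_poly iota d) (y ^+ (q ^ j)).
  have i_le : (i <= j + i * N)%N by rewrite (leq_trans (leq_pmulr i N_gt0)) ?leq_addl.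
  by rewrite -(period j i) -(subnKC i_le).
have d_neq0 : d != 0.
  by apply: contraTneq d_dvd => ->; rewrite dvd0p -size_poly_eq0 sizeg.
rewrite -dvdp_size_eqp // sizeg eqn_leq -{1}sizeg dvdp_leq -?size_poly_eq0 ?sizeg //=.
pose rs := [seq y ^+ (q ^ j) | j <- index_iota 0 N].
have : (size rs < size (map_poly iota d))%N.
  apply: max_poly_roots; first by rewrite map_poly_eq0.
    by apply/allP => _ /mapP[j _ ->].
  rewrite map_inj_in_uniq ?iota_uniq // => j j'; rewrite !mem_index_iota /= => jN jN'.
  exact: y_inj.
by rewrite size_map size_iota subn0 size_map_poly.
Qed.

(** Both sides are monic of degree [h * w]. Since [(y ^+ h) ^+ (q ^ i)] depends only on [i %% w],
    each of the distinct [y ^+ (q ^ i)] is a root of the factor with index [i %% w]. *)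
Lemma prod_XnsubC_orbit (L : fieldType) (y : L) (q w h : nat) :
  (0 < h)%N -> (y ^+ h) ^+ (q ^ w) = y ^+ h ->
  {in gtn (h * w) &, injective (fun i : nat => y ^+ (q ^ i))} ->
  \prod_(u < w) ('X^h - ((y ^+ h) ^+ (q ^ u))%:P) =
  \prod_(i < h * w) ('X - (y ^+ (q ^ i))%:P).
Proof.
move=> h_gt0 yhw y_inj; set P := \prod_(u < w) _.
have monicX u : ('X^h - ((y ^+ h) ^+ (q ^ u))%:P) \is monic.
  exact: monicXnsubC.
have P_monic : P \is monic by apply: monic_prod => u _.
have sizeP : size P = (h * w).+1.
  rewrite size_prod => [|u _]; last exact: monic_neq0.
  rewrite (eq_bigr (fun=> h.+1)); last by move=> u _; rewrite size_XnsubC.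
  rewrite sum_nat_const card_ord; lia.
pose rs := [seq y ^+ (q ^ i) | i <- index_iota 0 (h * w)].
rewrite (@all_roots_prod_XsubC _ P rs) ?(eqP P_monic) ?scale1r.
- by rewrite big_map big_mkord.
- by rewrite sizeP size_map size_iota subn0.
- apply/allP => _ /mapP[i i_in ->].
  have w_gt0 : (0 < w)%N by move: i_in; rewrite mem_index_iota; lia.
  have period j m : (y ^+ h) ^+ (q ^ (j + m * w)) = (y ^+ h) ^+ (q ^ j).
    elim: m => [|m IH]; first by rewrite addn0.
    by rewrite mulSn addnCA expnD exprM yhw.
  rewrite /root /P horner_prod prodf_seq_eq0.
  apply/hasP; exists (Ordinal (ltn_pmod i w_gt0)); first exact: mem_index_enum.
  rewrite /= !hornerE subr_eq0 [X in X == _]exprAC.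
  by rewrite {1}(divn_eq i w) addnC period.
- rewrite uniq_rootsE map_inj_in_uniq ?iota_uniq // => j j'.
  by rewrite !mem_index_iota /= => jN jN'; apply: y_inj.
Qed.

Lemma prim_expz (L : fieldType) (n : nat) (z : L) (m : int) :
  n.-primitive_root z -> coprimez m n -> n.-primitive_root (z ^ m).
Proof.
move=> prim_z com; have n_gt0 := prim_order_gt0 prim_z.
have m_ge0 : (0 <= m %% n)%Z by rewrite modz_ge0 // eqz_nat -lt0n.
have -> : z ^ m = z ^+ `|(m %% n)%Z|%N.
  apply/eqP; rewrite exprnP gez0_abs // (prim_expz_eq _ _ _ _ _ prim_z).
  by rewrite -eqz_mod_dvd modz_mod.
rewrite prim_root_exp_coprime //; move: com.
by rewrite /coprimez -gcdz_modl -/(coprimez _ _) coprimezE absz_nat.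
Qed.

(** * Factorization of the cyclotomic polynomial from representatives of the units modulo n under
    <q> *)

Section OrbitFactorization.

Variables (L : closedFieldType) (p k q : nat) (zeta : nat -> L) (n r w h : nat).
Variables (I : finType) (mu : I -> int).

Hypotheses (p_pr : prime p) (q_def : q = (p ^ k)%N).
Hypotheses (prim_n : n.-primitive_root (zeta n)) (co_nq : coprime n q).
Hypotheses (zeta_r : zeta r = zeta n ^+ h) (n_def : n = (r * h)%N).
Hypotheses (dvd_r : (r %| q ^ w - 1)%N) (hw_gt0 : (0 < h * w)%N).
Hypothesis dvd_n : forall j, (0 < j)%N -> (n %| q ^ j - 1)%N = (h * w %| j)%N.
Hypothesis mu_co : forall i, coprimez (mu i) n.
Hypothesis mu_inj : forall i i' j, (n %| mu i - mu i' * q%:Z ^+ j)%Z -> i = i'.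
Hypothesis card_I : (#|I| * (h * w))%N = totient n.

Let y i := zeta n ^ mu i.

Let q_gt0 : (0 < q)%N. Proof. by rewrite q_def expn_gt0 prime_gt0. Qed.

Let y_prim i : n.-primitive_root (y i).
Proof. exact: prim_expz. Qed.

Let y_fix i a b : (a <= b)%N ->
  (y i ^+ (q ^ a) == y i ^+ (q ^ b)) = (n %| q ^ (b - a) - 1)%N.
Proof.
move=> le_ab; rewrite (eq_prim_root_expr (y_prim i)) eq_sym eqn_mod_dvd; last first.
  by rewrite leq_pexp2l.
rewrite -{1}(subnK le_ab) expnD -{2}[(q ^ a)%N]mul1n -mulnBl Gauss_dvdl //.
exact: coprimeXr.
Qed.

Let y_inj i : {in gtn (h * w) &, injective (fun j : nat => y i ^+ (q ^ j))}.
Proof.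
have main a b : (a <= b < h * w)%N -> y i ^+ (q ^ a) = y i ^+ (q ^ b) -> a = b.
  case/andP=> le_ab ltb /eqP; rewrite y_fix //.
  have [/eqP ab0 _|ab_gt0] := posnP (b - a); first by apply/eqP; rewrite eqn_leq le_ab.
  by rewrite dvd_n // => /dvdn_leq; lia.
move=> a b /= lta ltb; rewrite !inE in lta ltb.
case/orP: (leq_total a b) => le_ab eq_y; first by apply: main; rewrite ?le_ab.
by apply/esym/main; rewrite ?le_ab.
Qed.

(** Vieta applies because [zeta r ^ mu i] is [y i ^+ h]; it is fixed by the [q ^ w] power because
    [r] divides [q ^ w - 1] and [n = r * h]. *)
Let factorE i : explicit_factor zeta q w r h (mu i) =
  \prod_(j < h * w) ('X - (y i ^+ (q ^ j))%:P).
Proof.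
have [h_gt0 w_gt0] : (0 < h)%N /\ (0 < w)%N by apply/andP; rewrite -muln_gt0.
rewrite -prod_XnsubC_orbit // -/(y i).
  rewrite (prod_subC_Vieta _ _ _ (fun u => (y i ^+ h) ^+ (q ^ u))).
  apply: eq_bigr => a _; rewrite -exprM; congr (_ * _ *: _).
  apply: eq_bigr => U _; apply: eq_bigr => u _.
  by rewrite zeta_r /y !exprnP !exprz_exp; congr (_ ^ _); ring.
apply/eqP; rewrite -exprM (eq_prim_root_expr (y_prim i)) eqn_mod_dvd.
  by rewrite -{2}[h]muln1 -mulnBr n_def mulnC dvdn_pmul2l.
by rewrite leq_pmulr // expn_gt0 q_gt0.
Qed.

Lemma cyclotomic_explicit_factor :
  cyclotomic (zeta n) n = \prod_i explicit_factor zeta q w r h (mu i).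
Proof.
under eq_bigr do rewrite factorE.
rewrite pair_bigA /=.
pose G (x : I * 'I_(h * w)) := y x.1 ^+ (q ^ x.2).
pose rs := map G (index_enum (I * 'I_(h * w))%type).
rewrite (@all_roots_prod_XsubC _ (cyclotomic (zeta n) n) rs) ?(eqP (cyclotomic_monic _ _)) ?scale1r.
- by rewrite big_map.
- rewrite size_cyclotomic size_map -card_I; congr _.+1.
  by rewrite /index_enum -enumT -cardE card_prod card_ord.
- apply/allP => _ /mapP[[i j] _ ->] /=.
  by rewrite root_cyclotomic // prim_root_exp_coprime // coprime_sym coprimeXr.
- rewrite uniq_rootsE map_inj_uniq ?index_enum_uniq // => -[i a] [i' b] /= eq_y.
  (* Cancelling the unit [q ^ c] modulo [n] leaves a relation with the single power [q ^ (d - c)],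
     the form that [mu_inj] takes. *)
  have main c d (j j' : I) : (c <= d)%N -> y j ^+ (q ^ c) = y j' ^+ (q ^ d) -> j = j'.
    move=> le_cd /eqP; rewrite /y !exprnP !exprz_exp (prim_expz_eq _ _ _ _ _ prim_n).
    have -> : mu j * (q ^ c)%N - mu j' * (q ^ d)%N =
              (mu j - mu j' * q%:Z ^+ (d - c)) * (q ^ c)%N.
      by rewrite -(subnKC le_cd) addKn expnD -!rmorphXn /= PoszM; ring.
    rewrite Gauss_dvdzl => [/mu_inj//|].
    by rewrite coprimezE /= coprimeXr.
  have eq_i : i = i'.
    case/orP: (leq_total a b) => le_ab; first exact: main eq_y.
    exact/esym/(main _ _ _ _ le_ab).
  by rewrite -eq_i in eq_y *; congr (_, _); apply/val_inj/(y_inj i) => //=; rewrite inE.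
Qed.

Variables (F : finFieldType) (iota : {rmorphism F -> L}).
Hypothesis cardF : #|F| = q.

Lemma explicit_factor_irreducible i :
  irreducible_over iota (explicit_factor zeta q w r h (mu i)).
Proof.
have pL : p \in [pchar L].
  by rewrite (fmorph_pchar iota); apply: (@card_finPcharP _ _ k); rewrite // cardF.
have [f fE] := Frobenius_power_rmorphism p k L pL.
rewrite factorE -cardF; apply: (irreducible_Frobenius_orbit _ _ _ f) => //.
- by move=> x; rewrite fE cardF q_def.
- rewrite cardF; apply/esym/eqP; rewrite -{1}[y i]expr1 -(expn0 q) y_fix //.
  by rewrite subn0 dvd_n.
- by rewrite cardF; apply: y_inj.
Qed.

End OrbitFactorization.

(** * Orders modulo the odd part *)

Lemma mulord_gt0 (N : nat) (a : int) : (0 < mulord N a)%N.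
Proof. by rewrite /mulord; case: ex_minnP => m /andP[]. Qed.

Lemma dvdz_expn_sub1 (N : nat) (a : int) (j : nat) : coprimez a N ->
  (N %| a ^+ j - 1)%Z = (mulord N a %| j)%N.
Proof.
move=> coaN; have [o_gt0 ao o_min] := mulordP coaN.
set o := mulord N a in o_gt0 ao o_min *.
have a_mod : (a ^+ j = a ^+ (j %% o) %[mod N])%Z.
  rewrite {1}(divn_eq j o) exprD mulnC exprM -modzMml -modzXm ao modzXm.
  by rewrite expr1n modzMml mul1r.
rewrite -eqz_mod_dvd a_mod; apply/eqP/idP => [aj|/eqP->]; last by rewrite expr0.
rewrite /dvdn -leqn0 leqNgt; apply/negP => j_gt0.
by have := o_min _ j_gt0 aj; rewrite leqNgt ltn_pmod.
Qed.

Lemma dvdn_sub1_posz (N q j : nat) : (0 < q)%N ->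
  (N %| q ^ j - 1)%N = (N%:Z %| q%:Z ^+ j - 1)%Z.
Proof.
by move=> q_gt0; rewrite -rmorphXn /= subzn ?expn_gt0 ?q_gt0 // dvdzE.
Qed.

Lemma dvdn_mulord (N q j : nat) : (0 < q)%N -> coprime q N ->
  (N %| q ^ j - 1)%N = (mulord N q %| j)%N.
Proof. by move=> q_gt0 co; rewrite dvdn_sub1_posz ?dvdz_expn_sub1. Qed.

Lemma totient_prod (I : finType) (f : I -> nat) :
  (forall i j, i != j -> coprime (f i) (f j)) ->
  totient (\prod_i f i) = (\prod_i totient (f i))%N.
Proof.
move=> cof; have: uniq (index_enum I) by exact: index_enum_uniq.
elim: (index_enum I) => [|i r IH]; first by rewrite !big_nil.
case/andP=> ir ur; rewrite !big_cons totient_coprime ?IH //.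
elim: r ir {IH ur} => [|j r IH]; first by rewrite big_nil coprimen1.
by rewrite inE negb_or big_cons coprimeMr => /andP[/cof-> /IH].
Qed.

(** Parity determines the lowest digit; subtracting it and halving gives the induction. *)
Lemma binary_digits_inj (m : nat) (t t' : 'I_m -> 'I_2) :
  ((2 ^ m)%N%:Z %| (\sum_(j < m) t j * 2 ^ j)%N%:Z - (\sum_(j < m) t' j * 2 ^ j)%N%:Z)%Z ->
  t =1 t'.
Proof.
elim: m t t' => [|m IH] t t' dvd_t; first by case.
have sumE (u : 'I_m.+1 -> 'I_2) : (\sum_(j < m.+1) u j * 2 ^ j =
    u ord0 + 2 * \sum_(j < m) u (lift ord0 j) * 2 ^ j)%N.
  rewrite big_ord_recl /= muln1 big_distrr /=; congr (_ + _)%N.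
  by apply: eq_bigr => j _; rewrite /bump /= add1n expnS mulnCA.
move: dvd_t; rewrite !sumE; set a := (\sum_(j < m) _)%N; set b := (\sum_(j < m) _)%N.
move=> dvd_ab.
have t0 : t ord0 = t' ord0.
  apply: val_inj => /=; move: dvd_ab; rewrite expnS PoszM => /dvdzP[c].
  by have := ltn_ord (t ord0); have := ltn_ord (t' ord0); lia.
have /IH tt : ((2 ^ m)%N%:Z %| a%:Z - b%:Z)%Z.
  move: dvd_ab; rewrite t0 expnS PoszM => /dvdzP[c ab]; apply/dvdzP; exists c.
  by apply: (@mulfI _ 2) => //; rewrite mulrCA -ab; lia.
move=> i; case: (unliftP ord0 i) => [j|] -> //.
Qed.

Section OddPart.

Variables (s q : nat) (ps e : 'I_s -> nat).
Hypotheses (ps_pr : forall i, prime (ps i)) (ps_odd : forall i, odd (ps i)).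
Hypotheses (ps_inj : injective ps) (e_gt0 : forall i, (0 < e i)%N).
Hypotheses (q_gt1 : (1 < q)%N) (ps_co : forall i, coprime q (ps i)).

Let q_gt0 : (0 < q)%N. Proof. exact: ltnW. Qed.

Let P i := (ps i ^ e i)%N.

Let coP i j d d' : i != j -> coprime (ps i ^ d) (ps j ^ d').
Proof.
move=> ne_ij; apply/coprimeXl/coprimeXr.
by rewrite prime_coprime // dvdn_prime2 // (inj_eq ps_inj).
Qed.

Let qP i d : coprime q (ps i ^ d). Proof. exact: coprimeXr. Qed.

Lemma omega0_gt0 : (0 < omega0 ps q)%N.
Proof.
rewrite /omega0; elim/big_ind: _ => // [a b a_gt0 b_gt0|i _].
  by rewrite lcmn_gt0 a_gt0.
exact: mulord_gt0.
Qed.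

Let A := (q ^ omega0 ps q)%N.

Lemma expn_omega0_gt1 : (1 < A)%N.
Proof. by rewrite -(exp1n (omega0 ps q)) ltn_exp2r ?omega0_gt0. Qed.

Let dvd_A i : (ps i %| A - 1)%N.
Proof. by rewrite dvdn_mulord // /omega0 (biglcmn_sup i). Qed.

Lemma odd_prod_ps (d : 'I_s -> nat) : odd (\prod_i ps i ^ d i)%N.
Proof.
elim/big_ind: _ => // [a b a_odd b_odd|i _]; first by rewrite oddM a_odd.
by rewrite oddX ps_odd orbT.
Qed.

Lemma h_odd_gt0 : (0 < h_odd ps e q)%N.
Proof. by apply: prodn_gt0 => i; rewrite expn_gt0 prime_gt0. Qed.

Lemma r_odd_mul_h_odd : (r_odd ps e q * h_odd ps e q)%N = odd_part ps e.
Proof.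
by rewrite -big_split /=; apply: eq_bigr => i _; rewrite -expnD subnK ?leq_subr.
Qed.

Lemma coprime_odd_part : coprime q (odd_part ps e).
Proof.
rewrite /odd_part; elim/big_ind: _ => // [|a b coa cob]; first exact: coprimen1.
by rewrite coprimeMr coa.
Qed.

Lemma dvdn_odd_part m : (odd_part ps e %| m)%N = [forall i, P i %| m]%N.
Proof. by rewrite prod_dvdn // => i j; apply: coP. Qed.

(** Every [ps i] divides [A - 1], so lifting the exponent turns divisibility of [A ^ m - 1] by
    [ps i ^ e i] into [ps i ^ Mexp ps e q i %| m]. An exponent that is no multiple of [omega0]
    already fails modulo some [ps i]. *)
Lemma dvdn_odd_part_sub1 j : (0 < j)%N ->
  (odd_part ps e %| q ^ j - 1)%N = (omega0 ps q * h_odd ps e q %| j)%N.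
Proof.
move=> j_gt0; have o_gt0 := omega0_gt0.
have key m : (0 < m)%N -> (odd_part ps e %| A ^ m - 1)%N = (h_odd ps e q %| m)%N.
  move=> m_gt0; rewrite dvdn_odd_part prod_dvdn; last by move=> i i'; apply: coP.
  apply: eq_forallb => i; rewrite dvdn_expn_sub1 ?expn_omega0_gt1 //.
  by move/eqP=> ps2; have := ps_odd i; rewrite ps2.
have [/dvdnP[m j_def]|oNj] := boolP (omega0 ps q %| j)%N.
  move: j_gt0; rewrite j_def muln_gt0 => /andP[m_gt0 _].
  by rewrite mulnC expnM key // dvdn_pmul2l.
rewrite [RHS](contraNF _ oNj); last by apply: dvdn_trans; rewrite dvdn_mulr.
apply: contraNF oNj; rewrite dvdn_odd_part => /forallP Pj.
apply/dvdn_biglcmP => i _; rewrite -dvdn_mulord //.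
by apply: dvdn_trans (Pj i); rewrite dvdn_exp.
Qed.

Lemma mulord_odd_part : mulord (odd_part ps e) q = (omega0 ps q * h_odd ps e q)%N.
Proof.
have oh_gt0 : (0 < omega0 ps q * h_odd ps e q)%N by rewrite muln_gt0 omega0_gt0 h_odd_gt0.
have eq_dvd j : (0 < j)%N ->
    (mulord (odd_part ps e) q %| j)%N = (omega0 ps q * h_odd ps e q %| j)%N.
  by move=> j_gt0; rewrite -dvdn_mulord ?dvdn_odd_part_sub1 // coprime_odd_part.
by apply/eqP; rewrite eqn_dvd eq_dvd // dvdnn -eq_dvd ?mulord_gt0 ?dvdnn.
Qed.

Lemma biglcm_f0 : \big[lcmn/1%N]_i f0 ps e q i = mulord (odd_part ps e) q.
Proof.
have eq_dvd j : (mulord (odd_part ps e) q %| j)%N = (\big[lcmn/1%N]_i f0 ps e q i %| j)%N.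
  rewrite -dvdn_mulord ?coprime_odd_part // dvdn_odd_part.
  apply/forallP/dvdn_biglcmP => [H i _|H i]; first by rewrite -dvdn_mulord ?qP // H.
  by rewrite dvdn_mulord ?qP // H.
by apply/eqP; rewrite eqn_dvd -eq_dvd dvdnn eq_dvd dvdnn.
Qed.

Lemma r_odd_dvd : (r_odd ps e q %| A - 1)%N.
Proof.
rewrite prod_dvdn => [|i j]; last exact: coP.
apply/forallP => i; rewrite pfactor_dvdn ?subn_gt0 ?expn_omega0_gt1 //.
by rewrite /Mexp -/A; lia.
Qed.

Lemma g0_mul_f0 i : (g0 ps e q i * f0 ps e q i)%N = totient (P i).
Proof.
rewrite divnK // -dvdn_mulord ?qP // -eqn_mod_dvd ?expn_gt0 ?q_gt0 //.
by apply/eqP; rewrite Euler_exp_totient ?qP.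
Qed.

(** By [prod_lcm_gcd] the product of the [g0 * f0] is the product of the bounds times the lcm of the
    [f0], and that lcm is the order of [q] modulo the odd part. *)
Lemma card_Sigma_star :
  (#|{: Sigma_star ps e q}| * mulord (odd_part ps e) q)%N = totient (odd_part ps e).
Proof.
rewrite card_dep_ffun foldrE big_map big_enum /=.
rewrite totient_prod => [|i j]; last exact: coP.
under [in RHS]eq_bigr do rewrite -g0_mul_f0.
rewrite big_split /= (prod_lcm_gcd _ (f0 ps e q)) biglcm_f0 mulnCA mulnC -big_split /=.
by congr (_ * _)%N; apply: eq_bigr => i _; rewrite card_ord.
Qed.

End OddPart.

(** * Coset representatives *)

Lemma eqz_mod_expr (N : nat) (a : int) (m n : nat) : coprimez a N ->
  (a ^+ m == a ^+ n %[mod N])%Z = (m == n %[mod mulord N a])%N.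
Proof.
move=> coaN; wlog le_mn : m n / (m <= n)%N => [IH|].
  by case/orP: (leq_total m n) => le_mn; [exact: IH | rewrite eq_sym IH // eq_sym].
rewrite eq_sym eqz_mod_dvd [RHS]eq_sym eqn_mod_dvd // -dvdz_expn_sub1 //.
have -> : a ^+ n - a ^+ m = a ^+ m * (a ^+ (n - m) - 1).
  by rewrite mulrBr mulr1 -exprD subnKC.
by rewrite Gauss_dvdzr // coprimez_sym coprimezXl.
Qed.

Section EtaPow.

Variables (s q : nat) (ps e : 'I_s -> nat) (eta : 'I_s -> int).
Hypotheses (ps_pr : forall i, prime (ps i)) (ps_inj : injective ps).
Hypotheses (e_gt0 : forall i, (0 < e i)%N).
Hypotheses (q_gt1 : (1 < q)%N) (ps_co : forall i, coprime q (ps i)).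
Hypothesis etaP : primitive_root_system ps e eta.

Let P i := (ps i ^ e i)%N.

Let eta_co i j : coprimez (eta j) (P i).
Proof.
have [->|ne_ij] := eqVneq i j.
  by have [/(_ (e j) (e_gt0 j))/andP[]] := etaP j.
have [_ /(_ i ne_ij) eta1] := etaP j.
by rewrite /coprimez -gcdz_modl eta1 gcdz_modl gcd1z.
Qed.

(** Every other [eta j] is 1 modulo [P i], so [x i] is the discrete logarithm of [eta^x] in the
    [i]-th Chinese remainder component. *)
Lemma eta_pow_mod i (x : Sigma_star ps e q) :
  (eta_pow eta x = eta i ^+ x i %[mod P i])%Z.
Proof.
rewrite /eta_pow (bigD1 i) //= -modzMmr.
have -> : (\prod_(j < s | j != i) eta j ^+ x j = 1 %[mod P i])%Z; last first.
  by rewrite modzMmr mulr1.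
elim/big_ind: _ => // [a b a1 b1|j ne_ji]; first by rewrite -modzMm a1 b1 modzMm.
have [_ /(_ i) eta1] := etaP j.
by rewrite -modzXm eta1 1?eq_sym // modzXm expr1n.
Qed.

Lemma coprimez_eta_pow (x : Sigma_star ps e q) :
  coprimez (eta_pow eta x) (odd_part ps e).
Proof.
rewrite /odd_part; elim/big_ind: _ => [|a b coa cob|i _]; first by rewrite coprimezE coprimen1.
  by rewrite PoszM coprimezMr coa.
by rewrite /coprimez -gcdz_modl (eta_pow_mod i) gcdz_modl; apply: coprimezXl.
Qed.

(* If the two tuples agree below [i], then [q ^ k] is trivial modulo the
   earlier prime powers, so [k] is a multiple of the lcm [l] of their orders.
   Raising to the power [f_i / gcd(l, f_i)] kills [q ^ k] modulo [p_i ^ e_i]. *)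
Lemma eta_pow_inj (x y : Sigma_star ps e q) (k : nat) :
  (odd_part ps e %| eta_pow eta x - eta_pow eta y * q%:Z ^+ k)%Z -> x = y.
Proof.
move=> dvd_xy.
have local i : (eta i ^+ x i = eta i ^+ y i * q%:Z ^+ k %[mod P i])%Z.
  rewrite -modzMml -!eta_pow_mod modzMml; apply/eqP; rewrite eqz_mod_dvd.
  by apply: dvdz_trans dvd_xy; rewrite /odd_part (bigD1 i) //= PoszM dvdz_mulr.
suff main n (i : 'I_s) : i = n :> nat -> x i = y i by apply/ffunP => i; apply: main.
elim/ltn_ind: n i => n IH i i_n.
have qP j : coprimez q (P j) by rewrite coprimezE /= coprimeXr.
set l := \big[lcmn/1%N]_(j < s | (j < i)%N) f0 ps e q j.
have l_dvd : (l %| k)%N.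
  apply/dvdn_biglcmP => j lt_ji; rewrite -dvdz_expn_sub1; last exact: qP.
  have /eqP := local j; rewrite (IH j) -?i_n // eq_sym eqz_mod_dvd.
  rewrite (_ : _ - _ = eta j ^+ y j * (q%:Z ^+ k - 1)); last by ring.
  by rewrite Gauss_dvdzr // coprimez_sym coprimezXl.
set f := f0 ps e q i; pose c := (f %/ gcdn l f)%N.
have f_gt0 : (0 < f)%N by exact: mulord_gt0.
have f_def : (gcdn l f * c = f)%N by rewrite mulnC divnK // dvdn_gcdr.
have c_gt0 : (0 < c)%N by move: f_gt0; rewrite -f_def muln_gt0 => /andP[].
have qkc : ((q%:Z ^+ k) ^+ c = 1 %[mod P i])%Z.
  apply/eqP; rewrite -exprM eqz_mod_dvd dvdz_expn_sub1; last exact: qP.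
  rewrite -/(f0 ps e q i) -/f -f_def.
  by rewrite dvdn_mul // (dvdn_trans _ l_dvd) // dvdn_gcdl.
have : (eta i ^+ (x i * c) == eta i ^+ (y i * c) %[mod P i])%Z.
  by rewrite exprM -modzXm local modzXm exprMn -modzMmr qkc modzMmr mulr1 -exprM.
rewrite eqz_mod_expr //.
have [/(_ (e i) (e_gt0 i))/andP[_ /eqP->] _] := etaP i.
(* The order of [eta i] is [g0 * gcdn l f * c]. Cancelling [c] leaves a congruence modulo
   [Sigma_bound], below which both exponents lie. *)
rewrite -(g0_mul_f0 _ q) // -/f -f_def mulnA -!muln_modl eqn_pmul2r //.
by rewrite !modn_small ?(ltn_ord (x i)) ?(ltn_ord (y i)) // => /eqP/val_inj.
Qed.

End EtaPow.

(* [c = 1] gives [mu_plus] and [c = 2] gives [mu_minus]. *)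
Definition mu_shift (c n' : nat) (gamma : int) (m : nat)
    (t : {ffun 'I_m -> 'I_2}) : int :=
  gamma + n'%:Z * (U0 n' gamma + (\sum_(j < m) t j * 2 ^ (c + j))%N%:Z).
Arguments mu_shift c n' gamma {m} t.

Section MuShift.

Variables (c n' m : nat) (gamma : int).
Hypothesis n'_odd : odd n'.
Implicit Types t : {ffun 'I_m -> 'I_2}.

Let sumE t : (\sum_(j < m) t j * 2 ^ (c + j) = 2 ^ c * \sum_(j < m) t j * 2 ^ j)%N.
Proof. by rewrite big_distrr; apply: eq_bigr => j _; rewrite expnD mulnCA. Qed.

(** For [c > 0] the digits contribute an even number, and replacing [phi0] by [1 - phi0] changes the
    even number [gamma + n' * phi0] by an odd one. *)
Lemma mu_shift_odd t : (0 < c)%N -> ~~ (2 %| mu_shift c n' gamma t)%Z.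
Proof.
case: c sumE => // c' sumE' _; rewrite /mu_shift sumE' expnS -mulnA.
set S := (2 ^ c' * _)%N; have := phi0_unique gamma (phi0 n' gamma) n'_odd.
rewrite eqxx /U0; set f := (phi0 n' gamma : nat) => /dvdzP[a gamma_def].
apply/negP => /dvdzP[b mu_def].
have n'E : n'%:Z = 2 * (b - a + n'%:Z * f%:Z - n'%:Z * S%:Z).
  by move: gamma_def mu_def; rewrite PoszM; lia.
by move: n'_odd; lia.
Qed.

Lemma mu_shift_mod t : (mu_shift c n' gamma t = gamma %[mod n'])%Z.
Proof. by apply/eqP; rewrite eqz_mod_dvd addrC addKr dvdz_mulr. Qed.

Lemma mu_shift_inj t t' :
  ((2 ^ (c + m))%N%:Z %| mu_shift c n' gamma t - mu_shift c n' gamma t')%Z -> t = t'.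
Proof.
rewrite /mu_shift !sumE; set a := (\sum_(j < m) _)%N; set b := (\sum_(j < m) _)%N.
rewrite (_ : _ - _ = n'%:Z * ((2 ^ c)%N%:Z * (a%:Z - b%:Z))); last first.
  by rewrite !PoszM; ring.
rewrite Gauss_dvdzr; last by rewrite coprimezE /= coprimeXl // coprime2n.
rewrite expnD PoszM dvdz_mul2l; last by rewrite eqz_nat expn_eq0.
by move/binary_digits_inj => tt'; apply/ffunP.
Qed.

End MuShift.

(** * Combining the cosets modulo n' with those modulo the power of 2 *)

Section Assembly.

Variables (p k q : nat) (F : finFieldType) (L : closedFieldType).
Variables (iota : {rmorphism F -> L}) (zeta : nat -> L).
Variables (s e0 : nat) (ps e : 'I_s -> nat) (eta : 'I_s -> int).
Hypotheses (p_pr : prime p) (p_odd : odd p) (k_gt0 : (0 < k)%N).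
Hypotheses (q_def : q = (p ^ k)%N) (cardF : #|F| = q).
Hypothesis zetaP : compatible_roots q zeta.
Hypothesis psP : forall i, [/\ prime (ps i), odd (ps i) & ps i != p].
Hypothesis ps_inj : injective ps.
Hypotheses (e0_gt0 : (0 < e0)%N) (e_gt0 : forall i, (0 < e i)%N).
Hypothesis etaP : primitive_root_system ps e eta.

Let n' := odd_part ps e.
Let n := (2 ^ e0 * n')%N.
Let Q := (q ^ mulord n' q)%N.
Let A := (q ^ omega0 ps q)%N.

Let ps_pr i : prime (ps i). Proof. by case: (psP i). Qed.
Let ps_odd i : odd (ps i). Proof. by case: (psP i). Qed.
Let q_gt1 : (1 < q)%N.
Proof. by rewrite q_def -(exp1n k) ltn_exp2r // prime_gt1. Qed.
Let q_gt0 : (0 < q)%N. Proof. exact: ltnW. Qed.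
Let q_odd : odd q. Proof. by rewrite q_def oddX p_odd orbT. Qed.
Let ps_co i : coprime q (ps i).
Proof.
rewrite q_def coprimeXl // prime_coprime // dvdn_prime2 //.
by case: (psP i) => _ _; rewrite eq_sym.
Qed.

(** Common core of both cases: [2 ^ a] is the order of [A] modulo [2 ^ e0], and the [m = e0 - 1 - a]
    digits count the remaining cosets. Units agreeing modulo [n'] can be related only by powers of
    [Q], so [t_inj] is required for [Q] alone. *)
Lemma explicit_factorization (c m a w r h : nat) :
  (0 < c)%N -> (r * h = n)%N -> (r %| q ^ w - 1)%N ->
  (h * w = omega0 ps q * (h_odd ps e q * 2 ^ a))%N -> (m + a).+1 = e0 ->
  (forall j, (0 < j)%N -> (2 ^ e0 %| A ^ j - 1)%N = (2 ^ a %| j)%N) ->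
  (forall gamma (t t' : {ffun 'I_m -> 'I_2}) j,
     ((2 ^ e0)%N%:Z %| mu_shift c n' gamma t - mu_shift c n' gamma t' * Q%:Z ^+ j)%Z ->
     t = t') ->
  let factor (x : Sigma_star ps e q) t :=
    explicit_factor zeta q w r h (mu_shift c n' (eta_pow eta x) t) in
  cyclotomic (zeta n) n = \prod_x \prod_(t : {ffun 'I_m -> 'I_2}) factor x t /\
  (forall x t, irreducible_over iota (factor x t)).
Proof.
move=> c_gt0 rh r_dvd hw ma dvdA t_inj factor.
have n'_odd : odd n' by exact: odd_prod_ps.
have o_gt0 : (0 < omega0 ps q)%N by exact: omega0_gt0.
have ho_gt0 : (0 < h_odd ps e q)%N by exact: h_odd_gt0.
have co_2n' d : coprime (2 ^ d) n' by rewrite coprimeXl // coprime2n.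
have co_nq : coprime n q.
  rewrite coprimeMl coprimeXl ?coprime2n //= coprime_sym.
  exact: coprime_odd_part.
have prim_n : n.-primitive_root (zeta n) by case: zetaP => prim _; apply: prim.
have /andP[r_gt0 h_gt0] : (0 < r)%N && (0 < h)%N.
  by rewrite -muln_gt0 rh (prim_order_gt0 prim_n).
have zeta_r : zeta r = zeta n ^+ h.
  case: zetaP => _ /(_ n r co_nq) <-; last by rewrite -rh dvdn_mulr.
  by rewrite -rh mulKn.
have hw_gt0 : (0 < h * w)%N by rewrite hw !muln_gt0 o_gt0 ho_gt0 expn_gt0.
have dvd_n j : (0 < j)%N -> (n %| q ^ j - 1)%N = (h * w %| j)%N.
  move=> j_gt0; rewrite [LHS]Gauss_dvd // /n' dvdn_odd_part_sub1 // hw.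
  (* For [j = i * omega0] the conditions [2 ^ a %| i] and [h_odd %| i] combine because [h_odd] is
     odd; for other [j] both sides are false. *)
  have [/dvdnP[i j_def]|oNj] := boolP (omega0 ps q %| j)%N; last first.
    have oN d : (omega0 ps q * d %| j)%N = false.
      by apply: contraNF oNj; apply: dvdn_trans; rewrite dvdn_mulr.
    by rewrite !oN andbF.
  move: j_gt0; rewrite j_def muln_gt0 => /andP[i_gt0 _].
  rewrite mulnC expnM dvdA // !dvdn_pmul2l // mulnC Gauss_dvd //.
  by rewrite coprimeXl // coprime2n; apply: odd_prod_ps.
pose I := (Sigma_star ps e q * {ffun 'I_m -> 'I_2})%type.
pose mu (x : I) := mu_shift c n' (eta_pow eta x.1) x.2.
have mu_co x : coprimez (mu x) n.
  rewrite PoszM coprimezMr; apply/andP; split.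
    rewrite coprimezE /= coprimeXr // coprime_sym coprime2n.
    have := mu_shift_odd c n' m (eta_pow eta x.1) n'_odd x.2 c_gt0.
    by rewrite dvdzE dvdn2 negbK.
  by rewrite /coprimez -gcdz_modl mu_shift_mod gcdz_modl; apply: coprimez_eta_pow.
have mu_inj x y j : (n %| mu x - mu y * q%:Z ^+ j)%Z -> x = y.
  rewrite PoszM Gauss_dvdz ?coprimezE //=; case/andP=> dvd2 dvdn'.
  have {}dvdn' : (n' %| eta_pow eta x.1 - eta_pow eta y.1 * q%:Z ^+ j)%Z.
    move: dvdn'; rewrite -!eqz_mod_dvd => /eqP.
    by rewrite /mu mu_shift_mod -modzMml mu_shift_mod modzMml => ->.
  case: x y => x t [y t'] /= in dvd2 dvdn' *.
  have eq_xy : x = y by apply: (eta_pow_inj s q ps e eta) dvdn'.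
  rewrite -{y}eq_xy in dvd2 dvdn' *; congr (_, _).
  (* With equal tuples, the unit [eta^x] cancels modulo [n'], so [q ^ j] is trivial there and is a
     power of [Q]. *)
  have /dvdnP[i j_def] : (mulord n' q %| j)%N.
    rewrite -dvdz_expn_sub1; last by rewrite coprimezE; apply: coprime_odd_part.
    move: dvdn'; rewrite -[in X in X - _](mulr1 (eta_pow eta x)) -mulrBr.
    rewrite Gauss_dvdzr; last by rewrite coprimez_sym; apply: coprimez_eta_pow.
    by rewrite -opprB rpredN.
  apply: (t_inj (eta_pow eta x) t t' i).
  by move: dvd2; rewrite j_def mulnC exprM -[q%:Z ^+ mulord n' q]rmorphXn.
have card_I : (#|{: I}| * (h * w))%N = totient n.
  rewrite totient_coprime // totient_pfactor // mul1n -ma card_prod card_ffun !card_ord hw.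
  rewrite -(card_Sigma_star s q ps e) // mulord_odd_part // expnD /=; ring.
split; last first.
  move=> x t; rewrite /factor -[mu_shift _ _ _ _]/(mu (x, t)).
  exact: (explicit_factor_irreducible L p k q zeta n).
rewrite (cyclotomic_explicit_factor L p k q zeta n r w h _ mu) //.
by rewrite pair_bigA.
Qed.

End Assembly.

(** * The prime 2 *)

Section TwoAdic.
Local Open Scope nat_scope.

Lemma odd_sqr_sub1 (a : nat) : odd a -> 4 %| a ^ 2 - 1.
Proof.
move=> a_odd; have -> : a = a./2.*2.+1 by rewrite -[LHS]odd_double_half a_odd.
by apply/dvdnP; exists (a./2 ^ 2 + a./2); rewrite -muln2; lia.
Qed.

Lemma odd_expn_mod4 (a m : nat) : odd a -> odd m -> a ^ m = a %[mod 4].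
Proof.
move=> a_odd m_odd; rewrite -[m]odd_double_half m_odd -muln2 mulnC expnD expnM.
have a2 : a ^ 2 = 1 %[mod 4].
  by apply/eqP; rewrite eqn_mod_dvd ?odd_sqr_sub1 // expn_gt0 odd_gt0.
by rewrite -modnMmr -modnXm a2 modnXm exp1n modnMmr muln1.
Qed.

Lemma logn2_expn_sub1_odd (a m : nat) : 1 < a -> 4 %| a - 1 -> odd m ->
  logn 2 (a ^ m - 1) = logn 2 (a - 1).
Proof.
move=> a_gt1 a4 m_odd; rewrite logn_expn_sub1 ?odd_gt0 //; last first.
  by apply: dvdn_trans a4.
by rewrite [logn 2 m]lognE dvdn2 m_odd andbF addn0.
Qed.

(** In [(a - 1) * (a + 1)] the first factor is 2 modulo 4 and contributes exactly 1. *)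
Lemma logn2_sqr_sub1 (a : nat) : a = 3 %[mod 4] ->
  logn 2 (a ^ 2 - 1) = (logn 2 (a + 1)).+1.
Proof.
move=> a3; have [b ->] : exists b, a = b * 4 + 3.
  by exists (a %/ 4); rewrite {1}(divn_eq a 4) a3.
have -> : (b * 4 + 3) ^ 2 - 1 = (b * 4 + 3 - 1) * (b * 4 + 3 + 1) by lia.
rewrite lognM; [|lia|lia]; rewrite -[RHS]add1n; congr (_ + _).
by apply: logn_eq1; rewrite // -addnBA // modnMDl.
Qed.

(* For [a = 3 mod 4] the exponent can only be lifted from [a ^ 2] on. *)
Lemma dvdn_expn_sub1_mod3 (a d m : nat) : a = 3 %[mod 4] -> 1 < d -> 0 < m ->
  (2 ^ d %| a ^ m - 1) = (2 ^ (d - logn 2 (a ^ 2 - 1)).+1 %| m).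
Proof.
move=> a3 d_gt1 m_gt0; have a_odd : odd a by lia.
have [m_odd|] := boolP (odd m).
  rewrite [RHS](_ : _ = false); last first.
    by apply/negP => /(dvdn_trans (dvdn_exp2l 2 (ltn0Sn _))); rewrite dvdn2 m_odd.
  apply/negP => /(dvdn_trans (dvdn_exp2l 2 d_gt1)) a1.
  have := odd_expn_mod4 a m a_odd m_odd; rewrite a3.
  move/eqP: a1; have := odd_gt0 (_ : odd (a ^ m)); rewrite oddX a_odd orbT => /(_ isT).
  by move: (a ^ m) => b; lia.
rewrite -dvdn2 => /dvdnP[m' m_def]; move: m_gt0; rewrite m_def muln_gt0 => /andP[m'_gt0 _].
rewrite mulnC expnM (expnS 2) dvdn_pmul2l // dvdn_expn_sub1 //.
- by rewrite -(exp1n 2) ltn_exp2r //; lia.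
- by apply: dvdn_trans (odd_sqr_sub1 _ a_odd).
- by move=> _; apply: odd_sqr_sub1.
Qed.

End TwoAdic.

Lemma mu_shift_inj_mod (c n' m d Q j : nat) (gamma : int) (t t' : {ffun 'I_m -> 'I_2}) :
  odd n' -> (0 < Q)%N -> (c + m <= d)%N -> (2 ^ (c + m) %| Q ^ j - 1)%N ->
  ((2 ^ d)%N%:Z %| mu_shift c n' gamma t - mu_shift c n' gamma t' * Q%:Z ^+ j)%Z ->
  t = t'.
Proof.
move=> n'_odd Q_gt0 le_d Q1 dvd_t; apply: (mu_shift_inj c n' m gamma n'_odd).
rewrite dvdn_sub1_posz // in Q1.
set u := mu_shift _ _ _ t in dvd_t *; set u' := mu_shift _ _ _ t' in dvd_t *.
have -> : u - u' = (u - u' * Q%:Z ^+ j) + u' * (Q%:Z ^+ j - 1) by ring.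
apply: rpredD; last exact: dvdz_mull.
by apply: dvdz_trans dvd_t; rewrite dvdzE /= dvdn_exp2l.
Qed.

(** * The two cases modulo 4 *)

Theorem corollary4p1 (p k q : nat) (F : finFieldType) (L : closedFieldType)
    (iota : {rmorphism F -> L}) (zeta : nat -> L)
    (s e0 : nat) (ps e : 'I_s -> nat) (eta : 'I_s -> int) :
  prime p -> odd p -> (0 < k)%N -> q = (p ^ k)%N -> #|F| = q ->
  is_algebraic_closure iota ->
  compatible_roots q zeta ->
  (forall i, [/\ prime (ps i), odd (ps i) & ps i != p]) ->
  injective ps ->
  (0 < e0)%N -> (forall i, (0 < e i)%N) ->
  primitive_root_system ps e eta ->
  let n' := odd_part ps e in
  let n := (2 ^ e0 * n')%N in
  let Q := (q ^ mulord n' q)%N in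
  (Q = 1 %[mod 4] ->
    let factor (x : Sigma_star ps e q) (t : {ffun 'I_(s_plus e0 Q) -> 'I_2}) :=
      explicit_factor zeta q (omega0 ps q) (r_plus ps e q e0 Q)
        (h_plus ps e q e0 Q) (mu_plus n' (eta_pow eta x) t) in
    cyclotomic (zeta n) n = \prod_x \prod_t factor x t /\
    (forall x t, irreducible_over iota (factor x t))) /\
  (Q = 3 %[mod 4] ->
    let factor (x : Sigma_star ps e q) (t : {ffun 'I_(s_minus e0 Q) -> 'I_2}) :=
      explicit_factor zeta q (omega0' ps q e0) (r_minus ps e q e0 Q)
        (h_minus ps e q e0 Q) (mu_minus n' (eta_pow eta x) t) in
    cyclotomic (zeta n) n = \prod_x \prod_t factor x t /\
    (forall x t, irreducible_over iota (factor x t))).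
Proof.
move=> p_pr p_odd k_gt0 q_def cardF _ zetaP psP ps_inj e0_gt0 e_gt0 etaP n' n Q.
have factorization := explicit_factorization p k q F L iota zeta s e0 ps e eta
  p_pr p_odd k_gt0 q_def cardF zetaP psP ps_inj e0_gt0 e_gt0 etaP.
rewrite -/n' -/n -/Q in factorization.
have ps_pr i : prime (ps i) by case: (psP i).
have ps_odd i : odd (ps i) by case: (psP i).
have q_gt1 : (1 < q)%N by rewrite q_def -(exp1n k) ltn_exp2r // prime_gt1.
have q_odd : odd q by rewrite q_def oddX p_odd orbT.
have ps_co i : coprime q (ps i).
  rewrite q_def coprimeXl // prime_coprime // dvdn_prime2 //.
  by case: (psP i) => _ _; rewrite eq_sym.
have n'_odd : odd n' by exact: odd_prod_ps.
have ho_odd : odd (h_odd ps e q) by exact: odd_prod_ps.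
have ro_odd : odd (r_odd ps e q) by exact: odd_prod_ps.
have rh_odd : (r_odd ps e q * h_odd ps e q)%N = n' by exact: r_odd_mul_h_odd.
set A := (q ^ omega0 ps q)%N in factorization.
have A_gt1 : (1 < A)%N by exact: expn_omega0_gt1.
have A_odd : odd A by rewrite oddX q_odd orbT.
(* As [h_odd] is odd, 2-adic information passes between [Q], in which the statement is phrased, and
   [A], to which lifting the exponent applies. *)
have Q_def : Q = (A ^ h_odd ps e q)%N by rewrite /Q mulord_odd_part // expnM.
have QA4 : Q = A %[mod 4] by rewrite Q_def odd_expn_mod4.
have r_dvdA : (r_odd ps e q %| A - 1)%N by exact: r_odd_dvd.
have Q_gt1 : (1 < Q)%N by rewrite Q_def -(exp1n (h_odd ps e q)) ltn_exp2r ?odd_gt0.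
have A_def : (q ^ omega0 ps q)%N = A by [].
clearbody A Q.
split=> [Q1|Q3].
- have A4 : (4 %| A - 1)%N.
    by rewrite -eqn_mod_dvd; [rewrite -QA4 Q1 | exact: ltnW A_gt1].
  have vE : logn 2 (Q - 1) = logn 2 (A - 1) by rewrite Q_def logn2_expn_sub1_odd.
  have v_ge2 : (2 <= logn 2 (A - 1))%N by rewrite -pfactor_dvdn // subn_gt0.
  have vQ d : (d <= logn 2 (A - 1) -> 2 ^ d %| Q - 1)%N.
    by rewrite -vE -pfactor_dvdn // subn_gt0.
  apply: (factorization 1%N _ (e0 - logn 2 (A - 1))%N) => //.
  + by rewrite /r_plus /h_plus vE mulnACA -expnD rh_odd; congr (2 ^ _ * _)%N; lia.
  + rewrite /r_plus vE A_def Gauss_dvd ?coprimeXl ?coprime2n // r_dvdA andbT.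
    by rewrite pfactor_dvdn ?subn_gt0 // geq_minr.
  + by rewrite /h_plus vE; ring.
  + by rewrite /s_plus vE; lia.
  + move=> j j_gt0; rewrite dvdn_expn_sub1 //.
    exact: dvdn_trans A4.
  (* Here [1 + s_plus] is the minimum of [e0] and the valuation of [Q - 1], so that power of 2
     divides every [Q ^ j - 1]. *)
  move=> gamma t t' j; apply: (mu_shift_inj_mod _ _ _ _ _ _ _ _ _ n'_odd (ltnW Q_gt1)).
    by rewrite /s_plus vE; lia.
  apply: (@dvdn_trans (Q - 1)); last by rewrite !subn1 predn_exp dvdn_mulr.
  by apply: vQ; rewrite /s_plus vE; lia.
have A3 : A = 3 %[mod 4] by rewrite -QA4.
have vE : (logn 2 (Q + 1)).+1 = logn 2 (A ^ 2 - 1).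
  rewrite -logn2_sqr_sub1 // Q_def -!expnM mulnC expnM.
  rewrite logn2_expn_sub1_odd ?odd_sqr_sub1 //.
  by rewrite -(exp1n 2) ltn_exp2r.
have sqA_gt1 : (1 < A ^ 2)%N by rewrite -(exp1n 2) ltn_exp2r.
have v_ge3 : (3 <= logn 2 (A ^ 2 - 1))%N.
  rewrite -vE ltnS -pfactor_dvdn ?addn1 //.
  by rewrite /dvdn -addn1 -modnDml Q3.
(* [2 ^ a] is the order of [A] modulo [2 ^ e0]: trivial modulo 2, and otherwise even because [A] is
   3 modulo 4. For [e0 = 2] the truncated difference is 0, so [a = 1]. *)
pose a := if e0 == 1%N then 0%N else (e0 - logn 2 (A ^ 2 - 1)).+1.
have aE : a = if (e0 == 1)%N then 0%N else if (e0 == 2)%N then 1%N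
              else (e0 - logn 2 (A ^ 2 - 1)).+1.
  by rewrite /a; have [//|_] := eqVneq e0 1%N; have [->|//] := eqVneq e0 2%N; lia.
apply: (factorization 2%N _ a) => //.
- rewrite /r_minus /h_minus addn1 vE /n -rh_odd.
  have [e2|e3] := leqP e0 2; last first.
    rewrite !ifN; [|lia|lia]; rewrite mulnACA -expnD; congr (2 ^ _ * _)%N; lia.
  have /orP[/eqP->|/eqP->] : (e0 == 1%N) || (e0 == 2%N) by lia.
    by rewrite /=; ring.
  by rewrite /=; ring.
- have [e2|e3] := leqP e0 2; rewrite /r_minus /omega0'.
    rewrite e2 A_def Gauss_dvd ?coprime2n // r_dvdA andbT dvdn2 oddB ?A_odd //.
    exact: ltnW A_gt1.
  rewrite leqNgt e3 /= Gauss_dvd ?coprimeXl ?coprime2n // addn1 vE mulnC expnM A_def.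
  rewrite pfactor_dvdn ?subn_gt0 // geq_minr /=.
  by apply: dvdn_trans r_dvdA _; rewrite !subn1 predn_exp dvdn_mulr.
(* One factor 2 of [2 ^ a] sits in [h_minus] when [e0 = 2], but in [omega0'] when [e0 >= 3]. *)
- rewrite /h_minus /omega0' aE addn1 vE.
  have [e2|e3] := leqP e0 2; last by rewrite !ifN ?expnS; first [lia | ring].
  have /orP[/eqP->|/eqP->] : (e0 == 1%N) || (e0 == 2%N) by lia.
    by rewrite /=; ring.
  by rewrite /=; ring.
- rewrite aE /s_minus; have [->|e0_neq1] := eqVneq e0 1%N; first by lia.
  by have [->|e0_neq2] := eqVneq e0 2%N; lia.
- move=> j j_gt0; rewrite /a; have [->|e0_neq1] := eqVneq e0 1%N.
    by rewrite dvd1n expn1 dvdn2 oddB ?expn_gt0 ?(ltnW A_gt1) // oddX A_odd orbT.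
  by rewrite dvdn_expn_sub1_mod3 //; lia.
move=> gamma t t' j dvd_t.
have [e2|e3] := leqP e0 2.
  apply/ffunP => -[i i_lt]; exfalso; move: i_lt; rewrite /s_minus; lia.
(* An odd [j] is impossible: [Q ^ j] is 3 modulo 4, while the digits start at weight 4, so both
   shifts agree modulo 4. Then 4 divides twice the second shift, which is odd. *)
have [j_odd|j_even] := boolP (odd j).
  have : (4%:Z %| mu_shift 2 n' gamma t - mu_shift 2 n' gamma t' * Q%:Z ^+ j)%Z.
    by apply: dvdz_trans dvd_t; rewrite dvdzE /= (dvdn_exp2l 2 (ltnW e3)).
  have : (Q%:Z ^+ j = 3 %[mod 4])%Z.
    rewrite -rmorphXn /= !modz_nat; congr Posz.
    by rewrite odd_expn_mod4 // Q_def oddX A_odd orbT.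
  have tt' : (4%:Z %| mu_shift 2 n' gamma t - mu_shift 2 n' gamma t')%Z.
    rewrite /mu_shift.
    have sumE (u : {ffun 'I_(s_minus e0 Q) -> 'I_2}) :
        (\sum_(i < s_minus e0 Q) u i * 2 ^ (2 + i) =
         4 * \sum_(i < s_minus e0 Q) u i * 2 ^ i)%N.
      by rewrite big_distrr; apply: eq_bigr => i _; rewrite expnD mulnCA.
    rewrite !sumE !PoszM; set x := Posz (\sum_(i < _) _); set y := Posz (\sum_(i < _) _).
    by apply/dvdzP; exists (n'%:Z * (x - y)); ring.
  have t'_odd : ~~ (2 %| mu_shift 2 n' gamma t')%Z by exact: mu_shift_odd.
  move/eqP; rewrite eqz_mod_dvd => /dvdzP[b Qb] /dvdzP[b1 tb1].
  move/dvdzP: tt' => [b2 tb2]; case/negP: t'_odd.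
  set u' := mu_shift 2 n' gamma t' in tb1 tb2 *.
  apply/dvdzP; exists (b2 - b1 - u' * b); move: tb1 tb2.
  have -> : Q%:Z ^+ j = b * 4 + 3 by rewrite -Qb subrK.
  move: (mu_shift _ _ _ t) => u; lia.
apply: (mu_shift_inj_mod _ _ _ _ _ _ _ _ _ n'_odd (ltnW Q_gt1)) dvd_t.
  by rewrite /s_minus; lia.
(* For even [j], [Q ^ 2 - 1] divides [Q ^ j - 1], and its valuation [logn 2 (Q + 1) + 1] is at least
   [2 + s_minus]. *)
apply: (@dvdn_trans (Q ^ 2 - 1)).
  rewrite pfactor_dvdn ?subn_gt0; first 1 last => //.
    by rewrite -(exp1n 2) ltn_exp2r.
  by rewrite logn2_sqr_sub1 // /s_minus; lia.
rewrite -(odd_double_half j) (negPf j_even) add0n -mul2n expnM !subn1 (predn_exp (Q ^ 2)).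
by rewrite dvdn_mulr.
Qed.
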